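(* Let $n,m,p\ge 1$, and let $A\in\mathbb{R}^{n\times n}$, $B\in\mathbb{R}^{n\times m}$, $C\in\mathbb{R}^{p\times n}$ with rows $C_1,\dots,C_p$, such that $(A,B)$ is controllable and $(C,A)$ is observable. Let $a(s)=\det(sI-A)$, $D_j(s)=C_j\operatorname{adj}(sI-A)B\in\mathbb{R}^{1\times m}[s]$ for $j=1,\dots,p$, let $e_i$ be the $i$th canonical row vector of $\mathbb{R}^{1\times m}$, and define $$\mathcal S_{\rm MIMO}=\{s^ra(s)e_i:r=0,\ldots,n-1,\ i=1,\ldots,m\}\cup\{s^rD_j(s):r=0,\ldots,n-1,\ j=1,\ldots,p\}\subset\mathbb{R}^{1\times m}[s].$$ Then $\dim\operatorname{span}\mathcal S_{\rm MIMO}=n(m+1)$ (span over $\mathbb{R}$). Equivalently, the complete filtered input--output vector $z(t)=\operatorname{col}(\zeta_{u_1}(t),\dots,\zeta_{u_m}(t),\zeta_{y_1}(t),\dots,\zeta_{y_p}(t))\in\mathbb{R}^{n(m+p)}$ contains only $n(m+1)$ linearly independent components, i.e. the linear space spanned by its $n(m+p)$ scalar components has dimension $n(m+1)$.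
   Context: $\mathbb{R}^{1\times m}[s]$ is the real vector space of polynomial row vectors of length $m$. The plant is $\dot x=Ax+Bu$, $y=Cx$ with $x(t)\in\mathbb{R}^n$, $u(t)\in\mathbb{R}^m$, $y(t)\in\mathbb{R}^p$, so in the Laplace domain (zero initial conditions) $Y_j(s)=\frac{D_j(s)}{a(s)}U(s)$ with $U(s)=[U_1(s),\dots,U_m(s)]^\top$. Filtered variables: let $\Lambda(s)=s^n+\alpha_{n-1}s^{n-1}+\cdots+\alpha_0$ be a chosen real Hurwitz polynomial, $A_f\in\mathbb{R}^{n\times n}$ its companion matrix and $b_f=[0,\dots,0,1]^\top$, so that $(sI-A_f)^{-1}b_f=\frac{1}{\Lambda(s)}[1,s,\dots,s^{n-1}]^\top$. Define $\dot\zeta_{u_i}=A_f\zeta_{u_i}+b_fu_i$ ($i=1,\dots,m$) and $\dot\zeta_{y_j}=A_f\zeta_{y_j}+b_fy_j$ ($j=1,\dots,p$), each in $\mathbb{R}^n$. Convention: linear relations among scalar components of filtered vectors (spans, independence, dimension, over $\mathbb{R}$) are understood for their Laplace-domain representations with zero initial conditions, i.e. for their row-vector transfer functions from $u$. After multiplication by $a(s)\Lambda(s)$, the $(r+1)$th component of $\zeta_{u_i}$ corresponds to $s^ra(s)e_i$ and that of $\zeta_{y_j}$ to $s^rD_j(s)$, $r=0,\dots,n-1$. *)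

(* Defs.v *)
From HB Require Import structures.
From mathcomp Require Import all_boot all_order all_algebra.
From mathcomp Require Import complex.
From mathcomp Require Import all_classical all_reals all_analysis.

Set Implicit Arguments.
Unset Strict Implicit.
Unset Printing Implicit Defensive.

Import Order.TTheory GRing.Theory Num.Theory.
Import numFieldNormedType.Exports.

Local Open Scope classical_set_scope.
Local Open Scope ring_scope.

(* K-linear algebra in an L-module, K acting through iota : K -> L.  The modules
   used below (polynomial and rational row vectors) have infinite dimension over
   the reals, so that {vspace _} and \dim do not apply to them. *)
Section LinearSpan.
Variables (K : fieldType) (L : comNzRingType) (iota : {rmorphism K -> L}).
Variable V : lmodType L.

Definition lcomb k (c : 'I_k -> K) (b : 'I_k -> V) : V :=
  \sum_(i < k) iota (c i) *: b i.

Definition lspan (S : set V) : set V :=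
  [set v | exists k (c : 'I_k -> K) (b : 'I_k -> V),
    (forall i, S (b i)) /\ v = lcomb c b].

Definition lin_free k (b : 'I_k -> V) : Prop :=
  forall c : 'I_k -> K, lcomb c b = 0 -> forall i, c i = 0.

Definition has_dim (W : set V) (d : nat) : Prop :=
  exists b : 'I_d -> V, lin_free b /\ W = lspan (range b).

End LinearSpan.

Section ControlTheory.
Variable R : realType.

(* x' = A x + f, entrywise.  For a linear system with continuous forcing term,
   trajectories on a bounded time interval extend to the whole real line. *)
Definition trajectory n (A : 'M[R]_n) (f x : R -> 'cV[R]_n) : Prop :=
  forall (t : R) (i : 'I_n),
    is_derive t 1 (fun s : R => x s i 0) ((A *m x t + f t) i 0).

Definition controllable n m (A : 'M[R]_n) (B : 'M[R]_(n, m)) : Prop :=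
  forall x0 x1 : 'cV[R]_n,
    exists (T : R) (u : R -> 'cV[R]_m) (x : R -> 'cV[R]_n),
      [/\ 0 < T,
          forall j, continuous (fun t : R => u t j 0),
          trajectory A (fun t => B *m u t) x,
          x 0 = x0 & x T = x1].

Definition observable n p (C : 'M[R]_(p, n)) (A : 'M[R]_n) : Prop :=
  exists2 T : R, 0 < T &
    forall x1 x2 : R -> 'cV[R]_n,
      trajectory A (fun=> 0) x1 -> trajectory A (fun=> 0) x2 ->
      (forall t : R, 0 <= t <= T -> C *m x1 t = C *m x2 t) ->
      x1 0 = x2 0.

Definition hurwitz (q : {poly R}) : Prop :=
  forall z : R[i], root (map_poly (real_complex R) q) z -> complex.Re z < 0.

(* D_j = C_j adj(sI - A) B *)
Definition numer n m p (A : 'M[R]_n) (B : 'M[R]_(n, m)) (C : 'M[R]_(p, n))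
    (j : 'I_p) : 'rV[{poly R}]_m :=
  map_mx polyC (row j C) *m \adj (char_poly_mx A) *m map_mx polyC B.

Definition S_MIMO n m p (A : 'M[R]_n) (B : 'M[R]_(n, m)) (C : 'M[R]_(p, n)) :
    set 'rV[{poly R}]_m :=
  [set v | exists (r : 'I_n) (i : 'I_m),
             v = ('X^r * char_poly A) *: delta_mx 0 i] `|`
  [set v | exists (r : 'I_n) (j : 'I_p), v = 'X^r *: numer A B C j].

Local Notation ratfun := {fraction {poly R}}.

Definition const_rat : {rmorphism R -> ratfun} :=
  (@tofrac {poly R}) \o (@polyC R).

(* C (sI - A)^-1 B *)
Definition transfer n m p (A : 'M[R]_n) (B : 'M[R]_(n, m)) (C : 'M[R]_(p, n)) :
    'M[ratfun]_(p, m) :=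
  map_mx const_rat C *m invmx (map_mx (@tofrac {poly R}) (char_poly_mx A))
    *m map_mx const_rat B.

(* Same entries as companionmx of mxpoly, whose size is (size q).-1; here the
   size is the state dimension n. *)
Definition companion n (q : {poly R}) : 'M[R]_n :=
  \matrix_(i < n, j < n)
    if i == n.-1 :> nat then - q`_j else (i.+1 == j :> nat)%:R.

Definition filter_input n : 'cV[R]_n := \col_(i < n) (i == n.-1 :> nat)%:R.

(* (sI - A_f)^-1 b_f *)
Definition filter_tf n (q : {poly R}) : 'cV[ratfun]_n :=
  transfer (companion n q) (filter_input n) 1%:M.

(* Transfer functions from u to the filtered variables: row r of each matrix is
   that of the r-th scalar component. *)
Definition zeta_u n m (q : {poly R}) (i : 'I_m) : 'M[ratfun]_(n, m) :=
  filter_tf n q *m delta_mx 0 i.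

Definition zeta_y n m p (A : 'M[R]_n) (B : 'M[R]_(n, m)) (C : 'M[R]_(p, n))
    (q : {poly R}) (j : 'I_p) : 'M[ratfun]_(n, m) :=
  filter_tf n q *m row j (transfer A B C).

Definition filtered_io n m p (A : 'M[R]_n) (B : 'M[R]_(n, m))
    (C : 'M[R]_(p, n)) (q : {poly R}) :
    'M[ratfun]_(\sum_(i < m) n + \sum_(j < p) n, m) :=
  col_mx (\mxcol_(i < m) zeta_u n q i) (\mxcol_(j < p) zeta_y A B C q j).

End ControlTheory.

(* Main.v *)
(* Write a(s) = det(sI - A) and h(x) = x adj(sI - A) B for a constant row x.
   Since (sI - A) adj(sI - A) = a I, one has s h(x) = a xB + h(xA), so modulo
   the space U spanned by the s^r a e_i (r < n), of dimension nm, the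
   polynomial s^r D_j = s^r h(C_j) is h(C_j A^r).  Observability makes the rows
   C_j A^r (r < n) span R^n, hence the span of S_MIMO is U + h(R^n).  The
   entries of h(x) have degree < n = deg a, so the sum is direct and h(x) = 0
   forces x A^r B = 0 for all r, i.e. x = 0 by controllability: the dimension
   is nm + n.  The rank conditions are extracted from the trajectory definitions
   with the power series of exp(tA) v.  The transfer functions of the filtered
   signals are the elements of S_MIMO divided by a Lambda. *)

Require Import Defs.
From HB Require Import structures.
From mathcomp Require Import all_boot all_order all_algebra.
From mathcomp Require Import perm complex.
From mathcomp Require Import all_classical all_reals all_analysis.

Set Implicit Arguments.
Unset Strict Implicit.
Unset Printing Implicit Defensive.

Import Order.TTheory GRing.Theory Num.Theory.
Import numFieldNormedType.Exports.

Local Open Scope classical_set_scope.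
Local Open Scope ring_scope.

(** * Spans and dimensions with scalars acting through a ring morphism *)

Section LinearSpanTheory.
Variables (K : fieldType) (L : comNzRingType) (iota : {rmorphism K -> L}).
Variable V : lmodType L.
Implicit Types (S : set V).

(** Enumerating [I] frees combinations from the ordinal indices in [lspan], so that sum types and
    pairs can serve as index sets. *)
Lemma lspan_fin S (I : finType) (c : I -> K) (b : I -> V) :
  (forall i, S (b i)) -> lspan iota S (\sum_i iota (c i) *: b i).
Proof.
move=> Sb; exists #|I|, (c \o enum_val), (b \o enum_val); split=> [i|]; first exact: Sb.
rewrite /lcomb (reindex (@enum_val I I)) /=; first exact: eq_bigl.
by exists enum_rank => i _; rewrite ?enum_valK ?enum_rankK.
Qed.

Lemma sub_lspan S : S `<=` lspan iota S.
Proof.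
move=> v Sv; exists 1, (fun=> 1), (fun=> v); split=> //.
by rewrite /lcomb big_ord1 rmorph1 scale1r.
Qed.

Lemma lspan0 S : lspan iota S 0.
Proof.
by exists 0, (fun=> 0), (fun=> 0); split=> [[]|]; rewrite // /lcomb big_ord0.
Qed.

Lemma lspanD S v w : lspan iota S v -> lspan iota S w -> lspan iota S (v + w).
Proof.
move=> [k [c [b [Sb ->]]]] [l [d [e [Se ->]]]].
pose f (s : 'I_k + 'I_l) := match s with inl i => c i | inr j => d j end.
pose g (s : 'I_k + 'I_l) := match s with inl i => b i | inr j => e j end.
have := @lspan_fin S _ f g; rewrite big_sumType /=; apply.
by case=> i; [exact: Sb | exact: Se].
Qed.

Lemma lspanZ S a v : lspan iota S v -> lspan iota S (iota a *: v).
Proof.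
move=> [k [c [b [Sb ->]]]]; exists k, (fun i => a * c i), b; split=> //.
by rewrite /lcomb scaler_sumr; apply: eq_bigr => i _; rewrite scalerA rmorphM.
Qed.

Lemma lspanB S v w : lspan iota S v -> lspan iota S w -> lspan iota S (v - w).
Proof.
move=> Sv Sw; apply: lspanD => //.
by rewrite -scaleN1r -(rmorphN1 iota); exact: lspanZ.
Qed.

Lemma lspan_sum S (I : finType) (F : I -> V) :
  (forall i, lspan iota S (F i)) -> lspan iota S (\sum_i F i).
Proof.
by move=> SF; apply: big_ind => //; [exact: lspan0 | exact: lspanD].
Qed.

Lemma lspan_min S S' : S `<=` lspan iota S' -> lspan iota S `<=` lspan iota S'.
Proof.
move=> SS' _ [k [c [b [Sb ->]]]]; apply: lspan_sum => i.
by apply: lspanZ; exact/SS'/Sb.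
Qed.

Lemma has_dim_fin (W : set V) (I : finType) (b : I -> V) :
    (forall c : I -> K, \sum_i iota (c i) *: b i = 0 -> forall i, c i = 0) ->
    W = lspan iota (range b) ->
  has_dim iota W #|I|.
Proof.
move=> free_b ->; exists (b \o enum_val); split.
  move=> c; rewrite /lcomb => c0 i.
  have := free_b (c \o enum_rank); rewrite (reindex (@enum_val I I)) /=; last first.
    by exists enum_rank => j _; rewrite ?enum_valK ?enum_rankK.
  under eq_bigr do rewrite enum_valK.
  rewrite (eq_bigl xpredT) // => /(_ c0 (enum_val i)).
  by rewrite enum_valK.
congr lspan; apply/seteqP; split=> _ [i _ <-]; last by exists (enum_val i).
by exists (enum_rank i) => //=; rewrite enum_rankK.
Qed.

End LinearSpanTheory.

(** Carries the dimension from polynomial rows to rational rows, on which the scalars act through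
    different morphisms. The image of a basis stays free because [f] is injective. *)
Lemma has_dim_image (K : fieldType) (L L' : comNzRingType)
    (iota : {rmorphism K -> L}) (iota' : {rmorphism K -> L'})
    (V : lmodType L) (V' : lmodType L') (f : {additive V -> V'})
    (S : set V) (d : nat) :
    (forall c v, f (iota c *: v) = iota' c *: f v) -> injective f ->
    has_dim iota (lspan iota S) d ->
  has_dim iota' (lspan iota' (f @` S)) d.
Proof.
move=> fZ f_inj [b [free_b Sb]].
have f_comb k c (e : 'I_k -> V) : f (lcomb iota c e) = lcomb iota' c (f \o e).
  by rewrite raddf_sum; apply: eq_bigr => i _; rewrite fZ.
have f_span S' : f @` lspan iota S' `<=` lspan iota' (f @` S').
  move=> _ [_ [k [c [e [Se ->]]]] <-]; exists k, c, (f \o e); split=> // i.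
  by exists (e i).
exists (f \o b); split=> [c|].
  by rewrite -f_comb -(raddf0 f) => /f_inj; exact: free_b.
apply/seteqP; split; apply: lspan_min.
  move=> _ [v Sv <-]; have : lspan iota S v by exact: sub_lspan.
  rewrite Sb => bv; have /f_span : (f @` lspan iota (range b)) (f v) by exists v.
  by rewrite image_comp.
move=> _ [i _ <-] /=; apply: f_span; exists (b i) => //.
by rewrite Sb; apply: sub_lspan; exists i.
Qed.

(** * The polynomial rows x adj(sI - A) B and their degrees *)

Section PolynomialResponse.
Variables (F : fieldType) (n m : nat) (A : 'M[F]_n) (B : 'M[F]_(n, m)).

(** The map h of the outline, extended to matrices [x]; at [row j C] it is [numer A B C j] by
    conversion. *)
Definition response k (x : 'M[F]_(k, n)) : 'M[{poly F}]_(k, m) :=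
  map_mx polyC x *m \adj (char_poly_mx A) *m map_mx polyC B.

Lemma response_mul k l (y : 'M[F]_(k, l)) (x : 'M[F]_(l, n)) :
  response (y *m x) = map_mx polyC y *m response x.
Proof. by rewrite /response map_mxM !mulmxA. Qed.

Lemma response_row k (x : 'M[F]_(k, n)) i :
  response (row i x) = row i (response x).
Proof. by rewrite /response map_row !row_mul. Qed.

Lemma response_comb k (y : 'rV[F]_k) (x : 'M[F]_(k, n)) :
  response (y *m x) = \sum_i (y 0 i)%:P *: response (row i x).
Proof.
rewrite response_mul mulmx_sum_row; apply: eq_bigr => i _.
by rewrite response_row mxE.
Qed.

Lemma response_sum k (I : finType) (x : I -> 'M[F]_(k, n)) :
  response (\sum_i x i) = \sum_i response (x i).
Proof. by rewrite /response raddf_sum !mulmx_suml. Qed.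

(* [adj] inverts [sI - A] up to [a], so multiplication by [s] acts as [A] modulo [a]. *)
Lemma mulX_response k (x : 'M[F]_(k, n)) :
  'X *: response x =
    char_poly A *: map_mx polyC (x *m B) + response (x *m A).
Proof.
have adjE : 'X *: \adj (char_poly_mx A) =
    (char_poly A)%:M + map_mx polyC A *m \adj (char_poly_mx A).
  rewrite -mul_mx_adj -mulmxDl -mul_scalar_mx; congr (_ *m _).
  by rewrite /char_poly_mx subrK.
rewrite /response !map_mxM scalemxAl scalemxAr adjE mulmxDr mulmxDl -!mulmxA.
by rewrite mul_scalar_mx -scalemxAr.
Qed.

Lemma size_sum_le (I : finType) (P : pred I) (f : I -> {poly F}) d :
  (forall i, P i -> (size (f i) <= d)%N) -> (size (\sum_(i | P i) f i)%R <= d)%N.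
Proof.
move=> fd; apply: (big_ind (fun q : {poly F} => (size q <= d)%N)) => //; first by rewrite size_poly0.
move=> p q pd qd; apply: leq_trans (size_polyD _ _) _.
by rewrite geq_max pd.
Qed.

(** In the Leibniz expansion each term is, up to sign, a product of k entries of degree at most
    1. *)
Lemma size_det_le k (M : 'M[{poly F}]_k) :
  (forall i j, size (M i j) <= 2)%N -> (size (\det M) <= k.+1)%N.
Proof.
move=> M2; apply: size_sum_le => s _.
have -> (b : bool) (q : {poly F}) : size ((-1) ^+ b * q) = size q.
  by rewrite mulr_sign; case: b; rewrite ?size_polyN.
apply: (leq_trans (size_poly_prod_leq xpredT (fun i => M i (s i)))).
rewrite leq_subLR card_ord addnS ltnS addnn -muln2.
apply: leq_trans (leq_sum _ (fun i _ => M2 i (s i))) _.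
by rewrite sum_nat_const card_ord.
Qed.

Lemma size_response k (x : 'M[F]_(k, n)) i j : (size (response x i j) <= n)%N.
Proof.
have size_adj r s : (size (\adj (char_poly_mx A) r s) <= n)%N.
  rewrite mxE /cofactor -signr_odd mulr_sign.
  (* The minors in the adjugate have order [n.-1], so their size is at most [n.-1.+1]; the index [r]
     excludes [n = 0]. *)
  have nE : n.-1.+1 = n by case: (n) r => [[]|].
  rewrite -[leqRHS]nE; case: ifP => _; rewrite ?size_polyN; apply: size_det_le => u v;
    rewrite !mxE -?fun_if;
    apply: leq_trans (size_polyD _ _) _; rewrite geq_max size_polyN size_polyC;
    case: (_ == _); rewrite ?mulr1n ?mulr0n ?size_polyX ?size_poly0 /=;
    by case: (_ != _).
have size_mulC (c : F) (p : {poly F}) : (size p <= n)%N -> (size (c%:P * p)%R <= n)%N.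
  by move=> pn; rewrite mul_polyC; apply: leq_trans (size_scale_leq _ _) pn.
rewrite mxE; apply: size_sum_le => l _; rewrite mulrC !mxE; apply: (size_mulC).
by apply: size_sum_le => r _; rewrite mxE; exact: size_mulC.
Qed.

(** Degree comparison: [char_poly A] is monic of degree n, so a nonzero entry of [q] would give a
    product of degree at least n, while the entries of the response have degree below n. *)
Lemma char_poly_response_eq0 k (q : 'M[{poly F}]_(k, m)) (x : 'M[F]_(k, n)) :
  char_poly A *: q + response x = 0 -> q = 0 /\ response x = 0.
Proof.
move=> qx0; suff q0 : q = 0 by split=> //; move: qx0; rewrite q0 scaler0 add0r.
apply/matrixP=> i j; rewrite [RHS]mxE; apply/eqP/negPn/negP=> qij0.
have /matrixP/(_ i j) := qx0; rewrite mxE [(_ *: q) i j]mxE [RHS]mxE => /eqP; rewrite addr_eq0 => /eqP.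
move=> /(congr1 (fun p : {poly F} => size p)).
rewrite size_polyN size_monicM ?char_poly_monic // size_char_poly /= => sz.
have := size_response x i j; rewrite -sz.
by rewrite -[leqRHS]addn0 leq_add2l leqn0 size_poly_eq0 (negPf qij0).
Qed.

(** If h(x) = 0, then 0 = s h(x) = a xB + h(xA), and the degree comparison gives xB = 0 and h(xA) =
    0; the argument repeats with xA in place of x. *)
Lemma response_eq0 k (x : 'M[F]_(k, n)) :
  response x = 0 -> forall r, x *m A ^+ r *m B = 0.
Proof.
move=> x0 r; elim: r x x0 => [|r IHr] x x0.
all: have := mulX_response x; rewrite x0 scaler0 => /esym/char_poly_response_eq0[xB xA].
  rewrite expr0 mulmx1; apply/matrixP=> i j; apply/eqP.
  by have /matrixP/(_ i j) := xB; rewrite !mxE => /eqP; rewrite polyC_eq0.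
by rewrite exprS -[A * _]/(A *m _) mulmxA; exact: IHr.
Qed.

End PolynomialResponse.

(** * Powers of A and the row space of the observability matrix *)

Lemma Cayley_Hamilton_span (F : fieldType) n (A : 'M[F]_n) k :
  exists c : 'I_n -> F, A ^+ k = \sum_(r < n) c r *: A ^+ r.
Proof.
case: n A => [|n] A; first by exists (fun=> 0); rewrite [LHS]thinmx0 [RHS]thinmx0.
(* The coefficients are those of the remainder of ['X^k] modulo the characteristic polynomial, which
   annihilates A. *)
pose q := 'X^k %% char_poly A.
have szq : (size q <= n.+1)%N.
  by rewrite -ltnS -(size_char_poly A) ltn_modp monic_neq0 // char_poly_monic.
exists (fun r => q`_r).
transitivity (horner_mx A 'X^k); first by rewrite rmorphXn /= horner_mx_X.
rewrite (divp_eq 'X^k (char_poly A)) rmorphD rmorphM /= Cayley_Hamilton mulr0 add0r.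
have -> : 'X^k %% char_poly A = \poly_(r < n.+1) q`_r.
  apply/polyP=> i; rewrite coef_poly; case: ltnP => // ni.
  by rewrite nth_default // (leq_trans szq).
rewrite poly_def raddf_sum; apply: eq_bigr => r _.
by rewrite /= horner_mxZ rmorphXn /= horner_mx_X.
Qed.

(** Duality: the columns of the cokernel of the joint row space are killed by C A^r for r < n, hence
    for all r by Cayley-Hamilton, hence vanish. A zero cokernel means that the row space is
    everything. *)
Lemma observability_span (F : fieldType) n p (C : 'M[F]_(p, n)) (A : 'M[F]_n) :
    (forall v : 'cV[F]_n, (forall r, C *m A ^+ r *m v = 0) -> v = 0) ->
  forall x : 'rV[F]_n, exists y : 'I_n -> 'rV[F]_p,
    x = \sum_(r < n) y r *m (C *m A ^+ r).
Proof.
move=> obs x; suff /sub_sumsmxP[y ->] : (x <= \sum_(r < n) <<C *m A ^+ r>>)%MS.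
  have yE r : exists z, y r *m <<C *m A ^+ r>>%MS = z *m (C *m A ^+ r).
    by apply/submxP; rewrite -(genmxE (C *m A ^+ r)) submxMl.
  by have [z zE] := choice yE; exists z; exact: eq_bigr.
rewrite submxE; set M := (\sum_(r < n) _)%MS.
suff -> : cokermx M = 0 by rewrite mulmx0.
have CM (r : 'I_n) : C *m A ^+ r *m cokermx M = 0.
  by apply/eqP; rewrite -submxE -(genmxE (C *m A ^+ r)); exact: sumsmx_sup (submx_refl _).
apply/matrixP=> i j; rewrite [RHS]mxE.
have /colP/(_ i) : col j (cokermx M) = 0.
  apply: obs => k; have [c ->] := Cayley_Hamilton_span A k.
  rewrite mulmx_sumr mulmx_suml big1 // => r _.
  by rewrite -scalemxAr -scalemxAl colE mulmxA CM mul0mx scaler0.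
by rewrite !mxE.
Qed.

(** * A basis of the span of [S_MIMO] *)

Section MIMO.
Variables (R : realType) (n m p : nat).
Variables (A : 'M[R]_n) (B : 'M[R]_(n, m)) (C : 'M[R]_(p, n)).
Local Notation a := (char_poly A).
Local Notation span := (lspan (@polyC R)).

Lemma span_char_poly (S : set 'rV[{poly R}]_m) (x : 'rV[R]_m) (r : 'I_n) :
    (forall i, S (('X^r * a) *: delta_mx 0 i)) ->
  span S (('X^r * a) *: map_mx polyC x).
Proof.
move=> SX; rewrite (row_sum_delta (map_mx polyC x)) scaler_sumr.
apply: lspan_sum => i; rewrite scalerA mulrC -scalerA mxE.
by apply: lspanZ; apply: sub_lspan.
Qed.

(** Generators of U, followed by the responses to the unit rows, which replace the family s^r D_j;
    the index type has nm + n elements. *)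
Definition MIMO_basis (s : 'I_n * 'I_m + 'I_n) : 'rV[{poly R}]_m :=
  match s with
  | inl (r, i) => ('X^r * a) *: delta_mx 0 i
  | inr k => response A B (delta_mx 0 k)
  end.

(** Both inclusions rest on s h(x) = a xB + h(xA): read forwards it lowers the power of s, read
    backwards it lowers the power of A. *)
Lemma lspan_S_MIMO :
    (forall v : 'cV[R]_n, (forall r, C *m A ^+ r *m v = 0) -> v = 0) ->
  span (S_MIMO A B C) = span (range MIMO_basis).
Proof.
move=> obs; have SX (r : 'I_n) i : S_MIMO A B C (('X^r * a) *: delta_mx 0 i) by left; exists r, i.
apply/seteqP; split; apply: lspan_min.
  move=> _ [[r [i ->]]|[r [j ->]]].
    by apply: sub_lspan; exists (inl (r, i)).
  rewrite -[numer A B C j]/(response A B (row j C)).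
  (* Stated for every row [x], not only the rows of C, because each reduction replaces x by xA. *)
  suff span_resp k x : (k < n)%N ->
    span (range MIMO_basis) ('X^k *: response A B x) by exact: span_resp.
  elim: k x => [|k IHk] x kn.
    rewrite expr0 scale1r -[x]mulmx1 response_comb; apply: lspan_sum => i.
    by rewrite row1; apply/lspanZ/sub_lspan; exists (inr i).
  rewrite exprSr -scalerA mulX_response scalerDr scalerA.
  apply: lspanD; last by apply: IHk; exact: ltnW.
  apply: (span_char_poly _ (r := Ordinal (ltnW kn))) => i.
  by exists (inl (Ordinal (ltnW kn), i)).
move=> _ [[[r i]|k] _ <-] /=; first exact: sub_lspan.
(* Each step trades one factor A for one factor s, so r + l is invariant; its bound by n keeps every
   exponent of s in the range allowed by [S_MIMO]. *)
have span_resp j l r : (r + l < n)%N ->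
    span (S_MIMO A B C) ('X^r *: response A B (row j C *m A ^+ l)).
  elim: l r => [|l IHl] r rln.
    rewrite addn0 in rln; apply: sub_lspan; right.
    by exists (Ordinal rln), j; rewrite expr0 mulmx1.
  have rn : (r < n)%N by apply: leq_ltn_trans rln; exact: leq_addr.
  suff -> : 'X^r *: response A B (row j C *m A ^+ l.+1) =
      'X^(r.+1) *: response A B (row j C *m A ^+ l) -
      ('X^r * a) *: map_mx polyC (row j C *m A ^+ l *m B).
    apply: lspanB; first by apply: IHl; rewrite addSnnS.
    exact: (span_char_poly _ (r := Ordinal rn)).
  rewrite (exprSr 'X r) -scalerA mulX_response scalerDr scalerA [in RHS]addrC addKr.
  by rewrite exprSr -mulmxA.
have [y ->] := observability_span obs (delta_mx 0 k).
rewrite response_sum; apply: lspan_sum => r.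
rewrite response_comb; apply: lspan_sum => j; apply: lspanZ.
by have := span_resp j r 0 (ltn_ord r); rewrite expr0 scale1r row_mul.
Qed.

Lemma MIMO_basis_free :
    (forall w : 'rV[R]_n, (forall r, w *m A ^+ r *m B = 0) -> w = 0) ->
  forall c : 'I_n * 'I_m + 'I_n -> R,
    \sum_s (c s)%:P *: MIMO_basis s = 0 -> forall s, c s = 0.
Proof.
move=> ctrl c.
(* The coefficients on U assemble into one polynomial row [q] and the others into one constant row
   [x], so a vanishing combination reads a q + h(x) = 0. *)
pose q := \row_i \sum_(r < n) (c (inl (r, i)))%:P * 'X^r.
pose x := \row_k c (inr k).
have -> : \sum_s (c s)%:P *: MIMO_basis s = a *: q + response A B x.
  rewrite big_sumType /=; congr (_ + _); last first.
    rewrite -[x]mulmx1 response_comb; apply: eq_bigr => k _.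
    by rewrite row1 mxE.
  transitivity (\sum_r \sum_i (c (inl (r, i)))%:P *: (('X^r * a) *: delta_mx 0 i :> 'rV_m)).
    by rewrite pair_big; apply: eq_bigr => -[].
  rewrite exchange_big (row_sum_delta q) scaler_sumr; apply: eq_bigr => i _.
  rewrite mxE scalerA mulr_sumr scaler_suml; apply: eq_bigr => r _.
  by rewrite scalerA mulrA mulrC.
move=> /char_poly_response_eq0[q0 /response_eq0/ctrl x0] [[r i]|k]; last first.
  by have /rowP/(_ k) := x0; rewrite !mxE.
have /rowP/(_ i)/polyP/(_ r) := q0.
rewrite !mxE coef_sum coef0 (bigD1 r) //= coefCM coefXn eqxx mulr1 big1 ?addr0 // => r' r'r.
by rewrite coefCM coefXn eq_sym (inj_eq val_inj) (negPf r'r) mulr0.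
Qed.

End MIMO.

(** * The power series of exp(tA) v, and rank conditions from trajectories *)

Section Flow.
Variables (R : realType) (n : nat) (A : 'M[R]_n).

(** The sum of all [|A i j|] bounds the action of A in the l1 norm; the resulting geometric growth
    makes the exponential series converge. *)
Lemma norm_iter_mulmx (v : 'cV[R]_n) k :
  \sum_i `|(A ^+ k *m v) i 0| <=
    (\sum_i \sum_j `|A i j|) ^+ k * \sum_i `|v i 0|.
Proof.
elim: k => [|k IHk]; first by rewrite !expr0 mul1mx mul1r.
rewrite !exprS -[A * _]/(A *m _) -mulmxA -mulrA.
set s := (\sum_i \sum_j _) in IHk *; set u := A ^+ k *m v in IHk *.
have s0 : 0 <= s by do 2!apply: sumr_ge0 => ? _.
apply: le_trans (ler_wpM2l s0 IHk); rewrite mulr_suml; apply: ler_sum => i _.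
rewrite mxE mulr_suml; apply: le_trans (ler_norm_sum _ _ _) _.
apply: ler_sum => j _; rewrite normrM; apply: ler_wpM2l => //.
by rewrite (bigD1 j) //= lerDl sumr_ge0.
Qed.

(** Taylor coefficients of the i-th entry of exp(tA) v, kept scalar so that the theory of real power
    series applies. *)
Definition flow_coef (v : 'cV[R]_n) (i : 'I_n) : R^nat :=
  fun k => (A ^+ k *m v) i 0 / k`!%:R.

Lemma is_cvg_flow v i t : cvgn (pseries (flow_coef v i) t).
Proof.
set s := \sum_i \sum_j `|A i j|; set w := \sum_i `|v i 0|.
have s0 : 0 <= s by do 2!apply: sumr_ge0 => ? _.
have w0 : 0 <= w by apply: sumr_ge0.
apply: normed_cvg.
(* Comparison with the series of w exp(s |t|). *)
apply: (@series_le_cvg _ _ (w *: exp_coeff (s * `|t|))) => [k|k|k|].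
- exact: normr_ge0.
- by rewrite mulr_ge0 // exp_coeff_ge0 // mulr_ge0.
- rewrite /flow_coef /exp_coeff /= /GRing.scale /= !normrM normfV normr_nat normrX.
  rewrite [leRHS]mulrA mulrAC; apply: ler_wpM2r; first by rewrite invr_ge0.
  rewrite exprMn mulrA; apply: ler_wpM2r; first exact: exprn_ge0.
  rewrite [w * _]mulrC; apply: le_trans (norm_iter_mulmx v k).
  by rewrite (bigD1 i) //= lerDl sumr_ge0.
- by apply: is_cvg_seriesZ; exact: is_cvg_series_exp_coeff.
Qed.

(** Formal differentiation cancels one factor of the factorial and leaves an extra A acting on v. *)
Lemma pseries_diffs_flow v i :
  pseries_diffs (flow_coef v i) = flow_coef (A *m v) i.
Proof.
apply/funext => k; rewrite /pseries_diffs /flow_coef exprSr mulmxA factS natrM.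
by rewrite invfM mulrCA mulVKf // pnatr_eq0.
Qed.

Definition flow (v : 'cV[R]_n) (t : R) : 'cV[R]_n :=
  \col_i limn (pseries (flow_coef v i) t).

Lemma flow0 v : flow v 0 = v.
Proof.
apply/colP => i; rewrite mxE; apply: lim_near_cst => //.
(* Every nonempty partial sum at t = 0 reduces to its constant term. *)
near=> N; rewrite -[N]prednK; last by near: N.
rewrite /pseries /series /= big_nat_recl //= big1 => [|k _].
  by rewrite /flow_coef !expr0 mul1mx fact0 divr1 mulr1 addr0.
by rewrite expr0n mulr0.
Unshelve. all: by end_near. Qed.

Lemma mulmx_flow p (C : 'M[R]_(p, n)) v t i :
  (C *m flow v t) i 0 =
    limn (series (fun k => (C *m A ^+ k *m v) i 0 / k`!%:R * t ^+ k)).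
Proof.
apply/esym/cvg_lim => //; rewrite mxE.
have -> : series (fun k => (C *m A ^+ k *m v) i 0 / k`!%:R * t ^+ k) =
    fun N => \sum_j C i j * pseries (flow_coef v j) t N.
  apply/funext => N; rewrite /pseries /series /=.
  under [RHS]eq_bigr do rewrite mulr_sumr.
  rewrite exchange_big; apply: eq_bigr => k _.
  rewrite -mulmxA mxE !mulr_suml; apply: eq_bigr => j _.
  by rewrite /flow_coef !mulrA.
apply: cvg_big => [|j _]; first exact: add_continuous.
rewrite mxE; apply: cvgMl_tmp.
exact: is_cvg_flow.
Qed.

Lemma flow_trajectory v : trajectory A (fun=> 0) (flow v).
Proof.
move=> t i; rewrite addr0.
have -> : (fun s => flow v s i 0) = fun s => limn (pseries (flow_coef v i) s).
  by apply/funext => s; rewrite mxE.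
have -> : (A *m flow v t) i 0 = limn (pseries (pseries_diffs (flow_coef v i)) t).
  rewrite mulmx_flow pseries_diffs_flow; congr (limn _).
  rewrite /pseries; congr series; apply/funext => k.
  by rewrite /flow_coef /= mulmxA -[A *m _]/(A * _) -exprS exprSr.
(* Termwise differentiation at t needs convergence at a point of larger modulus, here |t| + 1. *)
apply: (@pseries_snd_diffs _ _ (`|t| + 1)); rewrite ?pseries_diffs_flow; try exact: is_cvg_flow.
by rewrite [ltRHS]ger0_norm ?addr_ge0 // ltrDl.
Qed.

Lemma mulmx_flow_eq0 p (C : 'M[R]_(p, n)) v t :
  (forall k, C *m A ^+ k *m v = 0) -> C *m flow v t = 0.
Proof.
move=> Cv; apply/matrixP => i j; rewrite ord1 mulmx_flow [RHS]mxE.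
apply: lim_near_cst => //; apply: nearW => N.
by rewrite /series /= big1 // => k _; rewrite Cv mxE !mul0r.
Qed.

End Flow.

(** Along exp(tA) v the output vanishes identically, as it does along the zero trajectory;
    observability then equates the initial states v and 0. *)
Lemma observable_unobservable_eq0 (R : realType) n p (C : 'M[R]_(p, n)) (A : 'M[R]_n) :
    observable C A ->
  forall v : 'cV[R]_n, (forall r, C *m A ^+ r *m v = 0) -> v = 0.
Proof.
move=> [T _ obs] v Cv; rewrite -(flow0 A v).
apply: (obs _ (fun=> 0)) => [|t i|t _]; first exact: flow_trajectory.
- rewrite mulmx0 addr0 [X in is_derive _ _ _ X]mxE (_ : (fun=> _) = cst 0); first exact: is_derive_cst.
  by apply/funext => s; rewrite mxE.
- by rewrite mulmx0 mulmx_flow_eq0.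
Qed.

(* For [y' = A^T y], the function [t |-> y (T - t)^T x t] has derivative
   [y (T - t)^T B u t]. *)
Lemma controllable_unreachable_eq0 (R : realType) n m (A : 'M[R]_n) (B : 'M[R]_(n, m)) :
    controllable A B ->
  forall w : 'rV[R]_n, (forall r, w *m A ^+ r *m B = 0) -> w = 0.
Proof.
move=> ctrl w wB.
(* The target [w^T] is chosen so that the pairing below ends at the sum of squares of the entries of
   w. *)
have [T [u [x [_ _ dx x0 xT]]]] := ctrl 0 w^T.
pose y := flow A^T w^T.
have yB s : (y s)^T *m B = 0.
  apply: trmx_inj; rewrite trmx_mul trmxK trmx0; apply: mulmx_flow_eq0 => k.
  apply: trmx_inj; rewrite !trmx_mul !trmxK trmx0 mulmxA.
  have -> : (A^T ^+ k)^T = A ^+ k.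
    elim: k => [|k IHk]; first by rewrite !expr0 trmx1.
    by rewrite exprS exprSr -[_ * _]/(_ *m _) trmx_mul IHk trmxK.
  exact: wB.
have dy (i : 'I_n) (t : R) : is_derive t 1 (fun s => y (T - s) i 0) (- (A^T *m y (T - t)) i 0).
  have dTs : is_derive t 1 (fun s : R => T - s) (-1).
    by rewrite -[X in is_derive _ _ _ X]add0r; apply: is_deriveD.
  have := flow_trajectory A^T w^T (T - t) i; rewrite addr0 => dyi.
  have := @is_derive1_comp _ (fun s => y s i 0) _ t _ _ dyi dTs.
  by rewrite mulrN1.
pose g := \sum_(i < n) (fun s => y (T - s) i 0) * (fun s => x s i 0).
have gE s : g s = ((y (T - s))^T *m x s) 0 0.
  by rewrite /g fct_sumE mxE; apply: eq_bigr => i _; rewrite mxE.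
have dg (t : R) : is_derive t 1 g 0.
  have := is_derive_sum (fun i => is_deriveM (dy i t) (dx t i)).
  rewrite -/g; congr is_derive.
  transitivity (((y (T - t))^T *m (A *m x t + B *m u t)) 0 0
      - ((A^T *m y (T - t))^T *m x t) 0 0).
    rewrite [in RHS]mxE [((_ *m _)^T *m _) 0 0]mxE -sumrB.
    have trE (M : 'cV[R]_n) i : M^T 0 i = M i 0 by rewrite mxE.
    apply: eq_bigr => i _; rewrite !trE.
    by rewrite /GRing.scale /= mulrN [x t i 0 * _]mulrC.
  by rewrite mulmxDr [_ *m (B *m _)]mulmxA yB mul0mx addr0 trmx_mul trmxK mulmxA subrr.
(* The constant function g is 0 at time 0, since x starts at 0, and w w^T at time T, since y(0) =
   x(T) = w^T. *)
have := is_derive_0_is_cst T 0 dg.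
rewrite !gE subrr subr0 x0 mulmx0 /y flow0 xT trmxK [RHS]mxE => /eqP.
rewrite mxE psumr_eq0 => [/allP w0|i _]; last by rewrite mxE -expr2 sqr_ge0.
apply/rowP => i; have := w0 i; rewrite mem_index_enum => /(_ isT) /=.
by rewrite !mxE mulf_eq0 orbb => /eqP.
Qed.

(** * Transfer functions of the filtered signals *)

Lemma row_Rank_mxcol (T : Type) k (d : 'I_k -> nat) l (M : forall i, 'M[T]_(d i, l)) i r :
  row (tagnat.Rank i r) (\mxcol_i M i) = row r (M i).
Proof. by rewrite -[M i in RHS](mxcolK M); apply/rowP => j; rewrite !mxE. Qed.

(** On the column of powers of s, every row of sI - A_f but the last gives s s^i - s^(i+1) = 0, and
    the last row rebuilds q from its coefficients and leading term 1. Inverting yields (sI - A_f)^-1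
    b_f. *)
Lemma companion_mul n (R : realType) (q : {poly R}) :
    q \is monic -> size q = n.+1 ->
  char_poly_mx (companion n q) *m (\col_(r < n) 'X^r) =
    q *: map_mx polyC (filter_input R n).
Proof.
case: n => [|n] q_monic szq; first by rewrite [LHS]flatmx0 [RHS]flatmx0.
apply/colP => i; rewrite /char_poly_mx mulmxBl mul_scalar_mx !mxE.
have [iE|iN] := eqVneq (i : nat) n.
  rewrite mulr1; under eq_bigr do rewrite !mxE iE eqxx.
  rewrite iE -exprS -sumrN [q in RHS](_ : _ = \poly_(j < n.+2) q`_j); last first.
    by rewrite -szq coefK.
  rewrite poly_def [RHS]big_ord_recr /= [RHS]addrC.
  have -> : q`_n.+1 = 1 by have /monicP := q_monic; rewrite /lead_coef szq.
  rewrite scale1r; congr (_ + _); apply: eq_bigr => j _.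
  by rewrite polyCN mulNr opprK mul_polyC.
have lt_in : (i.+1 < n.+1)%N by rewrite ltnS ltn_neqAle iN -ltnS ltn_ord.
rewrite mulr0 (bigD1 (Ordinal lt_in)) //= !mxE (negPf iN) eqxx big1 => [|j jN].
  by rewrite mul1r addr0 exprS subrr.
rewrite !mxE (negPf iN); case: eqP => [ij|]; last by rewrite mul0r.
by case/eqP: jN; apply: val_inj.
Qed.

Section Filter.
Variables (R : realType) (n m p : nat).
Variables (A : 'M[R]_n) (B : 'M[R]_(n, m)) (C : 'M[R]_(p, n)).
Variable q : {poly R}.
Hypotheses (q_monic : q \is monic) (size_q : size q = n.+1).
Local Notation frac := (@tofrac {poly R}).

Lemma char_poly_mx_unit (M : 'M[R]_n) : map_mx frac (char_poly_mx M) \in unitmx.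
Proof.
by rewrite unitmxE det_map_mx unitfE tofrac_eq0 monic_neq0 // char_poly_monic.
Qed.

Lemma map_const_rat k l (M : 'M[R]_(k, l)) :
  map_mx (const_rat R) M = map_mx frac (map_mx polyC M).
Proof. by apply/matrixP => i j; rewrite !mxE. Qed.

Lemma filter_tfE : filter_tf n q = \col_r ((frac q)^-1 * frac 'X^r).
Proof.
have q0 : frac q != 0 by rewrite tofrac_eq0 monic_neq0.
rewrite /filter_tf /transfer map_mx1 mul1mx.
have /(congr1 (map_mx frac)) := companion_mul q_monic size_q.
rewrite map_mxM map_mxZ -map_const_rat.
move=> /(congr1 (mulmx (invmx (map_mx frac (char_poly_mx (companion n q)))))).
rewrite mulKmx ?char_poly_mx_unit // -scalemxAr => /(congr1 ( *:%R (frac q)^-1)).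
rewrite scalerA mulVf // scale1r => <-.
by apply/colP => r; rewrite !mxE.
Qed.

Lemma transferE :
  transfer A B C = (frac (char_poly A))^-1 *: map_mx frac (response A B C).
Proof.
have a0 : frac (char_poly A) != 0 by rewrite tofrac_eq0 monic_neq0 // char_poly_monic.
rewrite /transfer /response !map_const_rat !map_mxM scalemxAl scalemxAr.
congr (_ *m _ *m _).
apply: (can_inj (mulKmx (char_poly_mx_unit A))).
rewrite mulmxV ?char_poly_mx_unit // -scalemxAr -map_mxM mul_mx_adj map_scalar_mx.
by rewrite -mul_scalar_mx -scalar_mxM mulVf.
Qed.

(** Division by the common denominator a Lambda, which turns elements of [S_MIMO] into rows of the
    filtered transfer matrix. *)
Definition io_embed (v : 'rV[{poly R}]_m) : 'rV[{fraction {poly R}}]_m :=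
  (frac (char_poly A * q))^-1 *: map_mx frac v.

Lemma io_embed_inj : injective io_embed.
Proof.
move=> v w /(scalerI _) vw; apply/rowP => i.
have /vw/rowP/(_ i) : (frac (char_poly A * q))^-1 != 0.
  by rewrite invr_eq0 tofrac_eq0 monic_neq0 // monicMl // char_poly_monic.
by rewrite !mxE => /eqP; rewrite tofrac_eq => /eqP.
Qed.

Lemma io_embed_is_additive : zmod_morphism io_embed.
Proof. by move=> v w; rewrite /io_embed raddfB scalerBr. Qed.
HB.instance Definition _ :=
  GRing.isZmodMorphism.Build _ _ io_embed io_embed_is_additive.

Lemma io_embedZ (c : {poly R}) v : io_embed (c *: v) = frac c *: io_embed v.
Proof. by rewrite /io_embed map_mxZ !scalerA mulrC. Qed.

Lemma row_zeta_u (r : 'I_n) (i : 'I_m) :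
  row r (zeta_u n q i) = io_embed (('X^r * char_poly A) *: delta_mx 0 i).
Proof.
have a0 : frac (char_poly A) != 0 by rewrite tofrac_eq0 monic_neq0 // char_poly_monic.
rewrite /zeta_u filter_tfE row_mul /io_embed map_mxZ map_delta_mx scalerA.
rewrite [row r _](_ : _ = ((frac q)^-1 * frac 'X^r)%:M); last first.
  by apply/rowP => j; rewrite ord1 !mxE eqxx.
rewrite mul_scalar_mx !rmorphM invfM /=; congr (_ *: _).
by rewrite [_ * frac (char_poly A)]mulrC mulrACA mulVf // mul1r.
Qed.

Lemma row_zeta_y (r : 'I_n) (j : 'I_p) :
  row r (zeta_y A B C q j) = io_embed ('X^r *: numer A B C j).
Proof.
rewrite /zeta_y filter_tfE transferE row_mul /io_embed map_mxZ.
rewrite -[numer A B C j]/(response A B (row j C)) response_row map_row.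
rewrite [row r _](_ : _ = ((frac q)^-1 * frac 'X^r)%:M); last first.
  by apply/rowP => k; rewrite ord1 !mxE eqxx.
rewrite mul_scalar_mx linearZ /= !scalerA rmorphM invfM; congr (_ *: _).
by rewrite mulrC mulrA.
Qed.

Lemma range_filtered_io :
  range (fun k => row k (filtered_io A B C q)) = io_embed @` S_MIMO A B C.
Proof.
apply/seteqP; split.
  move=> _ [k _ <-]; rewrite /filtered_io; case: (split_ordP k) => s ->.
    rewrite rowKu row_mxcol row_zeta_u.
    by eexists; last reflexivity; left; exists (tagnat.sig2 s), (tagnat.sig1 s).
  rewrite rowKd row_mxcol row_zeta_y.
  by eexists; last reflexivity; right; exists (tagnat.sig2 s), (tagnat.sig1 s).
move=> _ [_ [[r [i ->]]|[r [j ->]]] <-].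
  (* [tagnat.Rank i r] is the position of component r of block i in the stacked column. *)
  exists (lshift _ (tagnat.Rank i r)) => //.
  by rewrite /filtered_io rowKu row_Rank_mxcol row_zeta_u.
exists (rshift _ (tagnat.Rank j r)) => //.
by rewrite /filtered_io rowKd row_Rank_mxcol row_zeta_y.
Qed.

End Filter.

(** * The dimension count, for polynomial rows and then for filtered signals *)

Theorem theorem3p13 (R : realType) (n m p : nat)
    (hn : (1 <= n)%N) (hm : (1 <= m)%N) (hp : (1 <= p)%N)
    (A : 'M[R]_n) (B : 'M[R]_(n, m)) (C : 'M[R]_(p, n))
    (hAB : controllable A B) (hCA : observable C A) :
  has_dim (@polyC R) (lspan (@polyC R) (S_MIMO A B C)) (n * m.+1)%N /\
  (forall Lambda : {poly R},
     Lambda \is monic -> size Lambda = n.+1 -> hurwitz Lambda ->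
     has_dim (const_rat R)
       (lspan (const_rat R)
          (range (fun k => row k (filtered_io A B C Lambda))))
       (n * m.+1)%N).
Proof.
have dimS : has_dim (@polyC R) (lspan (@polyC R) (S_MIMO A B C)) (n * m.+1)%N.
  have -> : (n * m.+1)%N = #|{: 'I_n * 'I_m + 'I_n}|.
    by rewrite card_sum card_prod !card_ord mulnS addnC.
  apply: (has_dim_fin (b := MIMO_basis A B)).
    by apply: MIMO_basis_free; exact: controllable_unreachable_eq0.
  by apply: lspan_S_MIMO; exact: observable_unobservable_eq0.
split=> // Lambda monicL sizeL _; rewrite range_filtered_io //.
apply: has_dim_image dimS => [c v|]; [exact: io_embedZ | exact: io_embed_inj].
Qed.
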